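(* Let $\mathcal{R}$ be a finite nonempty set (of robots). For each $r\in\mathcal{R}$ let $\mathcal{T}_r$ be a finite nonempty set (of candidate trajectories of $r$), the sets $\mathcal{T}_r$ being pairwise disjoint, and let $\mathcal{T}_{\mathcal{R}}=\bigcup_{r\in\mathcal{R}}\mathcal{T}_r$. Let $f:2^{\mathcal{T}_{\mathcal{R}}}\to\mathbb{R}$ be a non-decreasing submodular set function with $f(\emptyset)=0$ and $f(\{s\})\neq 0$ for every $s\in\mathcal{T}_{\mathcal{R}}$. Let $\alpha$ be an integer with $0\le\alpha<|\mathcal{R}|$. Let $$\mathcal{I}=\{\mathcal{S}\subseteq\mathcal{T}_{\mathcal{R}} : |\mathcal{S}\cap\mathcal{T}_r|=1\ \text{for all } r\in\mathcal{R}\},$$ and let $$f^\star=\max_{\mathcal{S}\in\mathcal{I}}\ \min_{\mathcal{A}\subseteq\mathcal{S},\ |\mathcal{A}|\le\alpha} f(\mathcal{S}\setminus\mathcal{A})$$ be the optimal value of the resilient multi-target tracking problem. For $\mathcal{S}\in\mathcal{I}$ let $\mathcal{A}^\star(\mathcal{S})$ denote a worst-case removal, i.e. an element of $\arg\min_{\mathcal{A}\subseteq\mathcal{S},\,|\mathcal{A}|\le\alpha} f(\mathcal{S}\setminus\mathcal{A})$. Define $$h(|\mathcal{R}|,\alpha)=\max\left[\frac{1}{1+\alpha},\ \frac{1}{|\mathcal{R}|-\alpha}\right].$$ Let $\nu_f(\mathcal{I})$ be the constrained curvature of $f$ over $\mathcal{I}$, and let $\mathcal{S}$ be the set returned by Algorithm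 1 on the input $(\mathcal{R},(\mathcal{T}_r)_{r\in\mathcal{R}},f,\alpha)$ (the constrained curvature and Algorithm 1 are defined in the context). Then: 1. (Approximation performance) $\mathcal{S}\in\mathcal{I}$, i.e. each robot is assigned a single trajectory, and $$\frac{f(\mathcal{S}\setminus\mathcal{A}^\star(\mathcal{S}))}{f^\star}\ \ge\ \frac{\max\left[\,1-\nu_f(\mathcal{I}),\ h(|\mathcal{R}|,\alpha)\,\right]}{2}.$$ 2. (Running time) Algorithm 1 constructs $\mathcal{S}$ with $O(|\mathcal{T}_{\mathcal{R}}|^2)$ evaluations of $f$.
   Context: Set functions: for a finite set $\mathcal{T}$, $f:2^{\mathcal{T}}\to\mathbb{R}$ is non-decreasing if $f(\mathcal{S})\le f(\mathcal{S}')$ whenever $\mathcal{S}\subseteq\mathcal{S}'\subseteq\mathcal{T}$. It is submodular if $f(\mathcal{S}\cup\{s\})-f(\mathcal{S})\ge f(\mathcal{S}'\cup\{s\})-f(\mathcal{S}')$ for all $\mathcal{S}\subseteq\mathcal{S}'\subseteq\mathcal{T}$ and all $s\in\mathcal{T}$. For an element $s$, $f(s)$ is shorthand for $f(\{s\})$. Constrained curvature: let $f:2^{\mathcal{T}}\to\mathbb{R}$ be non-decreasing and submodular with $f(s)\ne 0$ for all $s\in\mathcal{T}$, and let $\mathcal{I}$ be a collection of subsets of $\mathcal{T}$. The constrained curvature of $f$ over $\mathcal{I}$ is $$\nu_f(\mathcal{I})=1-\min_{\mathcal{S}\in\mathcal{I}}\ \min_{s\in\mathcal{S}}\ \frac{f(\mathcal{S})-f(\mathcal{S}\setminus\{s\})}{f(s)}.$$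 Algorithm 1 (input: $\mathcal{R}$, $(\mathcal{T}_r)_{r\in\mathcal{R}}$, $f$, $\alpha$; output: $\mathcal{S}$). Ties in every $\arg\max$ are broken arbitrarily. - Initialize $\mathcal{S}_1=\mathcal{M}_1=\mathcal{S}_2=\mathcal{M}_2=\emptyset$. - While $\mathcal{M}_1\neq\mathcal{T}_{\mathcal{R}}$: pick $s\in\arg\max_{y\in\mathcal{T}_{\mathcal{R}}\setminus\mathcal{M}_1} f(y)$. If $|(\mathcal{S}_1\cup\{s\})\cap\mathcal{T}_r|\le 1$ for all $r\in\mathcal{R}$ and $|\mathcal{S}_1\cup\{s\}|\le\alpha$, then set $\mathcal{S}_1\leftarrow\mathcal{S}_1\cup\{s\}$. In either case set $\mathcal{M}_1\leftarrow\mathcal{M}_1\cup\{s\}$. - While $\mathcal{M}_2\neq\mathcal{T}_{\mathcal{R}}\setminus\mathcal{S}_1$: pick $s\in\arg\max_{y\in\mathcal{T}_{\mathcal{R}}\setminus(\mathcal{S}_1\cup\mathcal{M}_2)} \big[f(\mathcal{S}_2\cup\{y\})-f(\mathcal{S}_2)\big]$. If $|(\mathcal{S}_1\cup\mathcal{S}_2\cup\{s\})\cap\mathcal{T}_r|\le 1$ for all $r\in\mathcal{R}$, then set $\mathcal{S}_2\leftarrow\mathcal{S}_2\cup\{s\}$. In either case set $\mathcal{M}_2\leftarrow\mathcal{M}_2\cup\{s\}$. - Return $\mathcal{S}=\mathcal{S}_1\cup\mathcal{S}_2$. The running time is measured by the number of evaluations of $f$ (value-oracle calls). *)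

(* Defs.v *)
From mathcomp Require Import all_boot all_order all_algebra.

Set Implicit Arguments.
Unset Strict Implicit.
Unset Printing Implicit Defensive.

Import Order.TTheory GRing.Theory Num.Theory.
Local Open Scope ring_scope.

Section Extrema.
Variables (K : realFieldType) (X : finType).
Implicit Types (P : {set X}) (F : X -> K).

(* Only meaningful for nonempty P; the value on the empty set is a dummy 0. *)
Definition min_over P F : K :=
  if [pick i in P] is Some i0 then F [arg min_(i < i0 in P) F i]%O else 0.

Definition max_over P F : K :=
  if [pick i in P] is Some i0 then F [arg max_(i > i0 in P) F i]%O else 0.

Lemma min_overP P F : P != set0 ->
  (exists2 i, i \in P & F i = min_over P F) /\
  (forall i, i \in P -> min_over P F <= F i).
Proof.
move=> /set0Pn[j jP]; rewrite /min_over; case: pickP => [i0 i0P|/(_ j)]; last first.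
  by rewrite jP.
by case: arg_minP => // i iP ile; split=> //; exists i.
Qed.

Lemma max_overP P F : P != set0 ->
  (exists2 i, i \in P & F i = max_over P F) /\
  (forall i, i \in P -> F i <= max_over P F).
Proof.
move=> /set0Pn[j jP]; rewrite /max_over; case: pickP => [i0 i0P|/(_ j)]; last first.
  by rewrite jP.
by case: arg_maxP => // i iP ile; split=> //; exists i.
Qed.

End Extrema.

Section SetFunctions.
Variables (K : realFieldType) (T : finType).
Implicit Types (f : {set T} -> K) (I : {set {set T}}) (S A : {set T}).

Definition nondecreasing_setfun f :=
  forall S S' : {set T}, S \subset S' -> f S <= f S'.

Definition submodular f :=
  forall (S S' : {set T}) (s : T), S \subset S' ->
    f (s |: S') - f S' <= f (s |: S) - f S.

Definition constrained_curvature f I : K :=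
  1 - min_over I (fun S => min_over S (fun s => (f S - f (S :\ s)) / f [set s])).

Definition removals (alpha : nat) S : {set {set T}} :=
  [set A : {set T} | (A \subset S) && (#|A| <= alpha)%N].

Definition worst_removal f (alpha : nat) S A :=
  A \in removals alpha S /\
  forall B, B \in removals alpha S -> f (S :\: A) <= f (S :\: B).

Definition resilient_opt f (alpha : nat) I : K :=
  max_over I (fun S => min_over (removals alpha S) (fun A => f (S :\: A))).

End SetFunctions.

(* r and alpha are naturals, but the subtraction is that of K. *)
Definition h_bound (K : realFieldType) (r alpha : nat) : K :=
  Num.max (1 / (1 + alpha%:R)) (1 / (r%:R - alpha%:R)).

Section Trajectories.
Variables (Rb T : finType) (Tr : Rb -> {set T}).

Definition all_trajectories : {set T} := \bigcup_r Tr r.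

Definition assignments : {set {set T}} :=
  [set S : {set T} | (S \subset all_trajectories)
                     && [forall r, #|S :&: Tr r| == 1%N]].

End Trajectories.

(* Value-oracle computations: a computation has no access to the set function
   other than through Query, so counting the Query nodes along an execution counts
   its evaluations.  Choose C is the nondeterministic choice of an element of C. *)
Inductive prog (K : Type) (T : finType) (A : Type) : Type :=
| Ret of A
| Query of {set T} & (K -> prog K T A)
| Choose of {set T} & (T -> prog K T A).

Arguments Ret {K T A}.
Arguments Query {K T A}.
Arguments Choose {K T A}.

Fixpoint bind (K : Type) (T : finType) (A B : Type)
    (p : prog K T A) (q : A -> prog K T B) : prog K T B :=
  match p with
  | Ret a => q a
  | Query X k => Query X (fun v => bind (k v) q)
  | Choose C k => Choose C (fun s => bind (k s) q)
  end.

(* runs f p a n: with oracle f, some execution of p returns a after exactly n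
   evaluations of f. *)
Fixpoint runs (K : Type) (T : finType) (A : Type) (f : {set T} -> K)
    (p : prog K T A) (a : A) (n : nat) : Prop :=
  match p with
  | Ret b => a = b /\ n = 0%N
  | Query X k => exists2 m, n = m.+1 & runs f (k (f X)) a m
  | Choose C k => exists2 s, s \in C & runs f (k s) a n
  end.

(* No execution of p ever has to choose from an empty set. *)
Fixpoint unstuck (K : Type) (T : finType) (A : Type) (f : {set T} -> K)
    (p : prog K T A) : Prop :=
  match p with
  | Ret _ => True
  | Query X k => unstuck f (k (f X))
  | Choose C k => C != set0 /\ forall s, s \in C -> unstuck f (k s)
  end.

Record store (T : finType) := Store
  { sol1 : {set T}; seen1 : {set T}; sol2 : {set T}; seen2 : {set T} }.

Inductive cmd (K : Type) (T : finType) : Type :=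
| Act of (store T -> prog K T (store T))
| Seq of cmd K T & cmd K T
| While of (store T -> bool) & cmd K T.

(* exec f c s s' n: some execution of c from s ends in s' after exactly n
   evaluations of f. *)
Inductive exec (K : Type) (T : finType) (f : {set T} -> K) :
    cmd K T -> store T -> store T -> nat -> Prop :=
| exec_act p s s' n : runs f (p s) s' n -> exec f (Act p) s s' n
| exec_seq c1 c2 s s' s'' m n :
    exec f c1 s s' m -> exec f c2 s' s'' n -> exec f (Seq c1 c2) s s'' (m + n)
| exec_while_end (b : store T -> bool) c s : ~~ b s -> exec f (While b c) s s 0
| exec_while_step (b : store T -> bool) c s s' s'' m n :
    b s -> exec f c s s' m -> exec f (While b c) s' s'' n ->
    exec f (While b c) s s'' (m + n).

(* halts f c s: every execution of c from s is finite and none gets stuck. *)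
Inductive halts (K : Type) (T : finType) (f : {set T} -> K) :
    cmd K T -> store T -> Prop :=
| halts_act p s : unstuck f (p s) -> halts f (Act p) s
| halts_seq c1 c2 s :
    halts f c1 s -> (forall s' n, exec f c1 s s' n -> halts f c2 s') ->
    halts f (Seq c1 c2) s
| halts_while_end (b : store T -> bool) c s : ~~ b s -> halts f (While b c) s
| halts_while_step (b : store T -> bool) c s :
    b s -> halts f c s ->
    (forall s' n, exec f c s s' n -> halts f (While b c) s') ->
    halts f (While b c) s.

Section Algorithm.
Variables (K : realFieldType) (Rb T : finType).
Variables (Tr : Rb -> {set T}) (alpha : nat).

Fixpoint tabulate (g : T -> prog K T K) (ys : seq T) : prog K T (T -> K) :=
  if ys is y :: ys' then
    bind (g y) (fun v =>
    bind (tabulate g ys') (fun t =>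
    Ret (fun z => if z == y then v else t z)))
  else Ret (fun=> 0).

Definition pick_argmax (C : {set T}) (g : T -> prog K T K) : prog K T T :=
  bind (tabulate g (enum C)) (fun t =>
  Choose [set y in C | [forall z in C, t z <= t y]] Ret).

Definition at_most_one_each (S : {set T}) : bool :=
  [forall r, (#|S :&: Tr r| <= 1)%N].

Definition value (y : T) : prog K T K := Query [set y] Ret.

Definition marginal (S : {set T}) (y : T) : prog K T K :=
  Query (y |: S) (fun u => Query S (fun v => Ret (u - v))).

Definition body1 (st : store T) : prog K T (store T) :=
  let: Store S1 M1 S2 M2 := st in
  bind (pick_argmax (all_trajectories Tr :\: M1) value) (fun s =>
  Ret (Store
    (if at_most_one_each (s |: S1) && (#|s |: S1| <= alpha)%N
     then s |: S1 else S1)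
    (s |: M1) S2 M2)).

Definition body2 (st : store T) : prog K T (store T) :=
  let: Store S1 M1 S2 M2 := st in
  bind (pick_argmax (all_trajectories Tr :\: (S1 :|: M2)) (marginal S2)) (fun s =>
  Ret (Store S1 M1
    (if at_most_one_each (S1 :|: (s |: S2)) then s |: S2 else S2)
    (s |: M2))).

Definition alg1 : cmd K T :=
  Seq (While (fun st => seen1 st != all_trajectories Tr) (Act body1))
      (While (fun st => seen2 st != all_trajectories Tr :\: sol1 st) (Act body2)).

Definition alg1_init : store T := Store set0 set0 set0 set0.

Definition alg1_terminates (f : {set T} -> K) : Prop := halts f alg1 alg1_init.

(* The algorithm may return S after exactly n evaluations of f; several S are
   possible because ties are broken arbitrarily. *)
Definition alg1_returns (f : {set T} -> K) (S : {set T}) (n : nat) : Prop :=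
  exists2 st, exec f alg1 alg1_init st n & S = sol1 st :|: sol2 st.

End Algorithm.

(* Main.v *)
(* Write S = S1 U S2 for the output, S1 being the bait part.  The second loop is a
   greedy algorithm for the partition matroid of the robots not served by S1, so
   2 f(S2) dominates the value of every assignment of those robots; and f* is at
   most such a value, since the adversary may remove the alpha trajectories of the
   robots served by S1.  Hence f* <= 2 f(S2), and it remains to bound
   f(S \ A) / f(S2) from below.  Since |S1| = alpha >= |A|, at least |A n S2|
   elements of S1 survive, and each of them has a singleton value at least as large
   as that of every element of S2.  Charging the removed elements of S2 to these
   survivors gives the factor 1 - nu (using f(X) >= (1 - nu) sum_{x in X} f(x) for
   X included in S); charging all of them to a single survivor gives 1 / (1 + alpha),
   and charging the whole of S2 to it gives 1 / (|R| - alpha). *)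
Require Import Defs.
From mathcomp Require Import all_boot all_order all_algebra.
From mathcomp Require Import lra.
Set Implicit Arguments.
Unset Strict Implicit.
Unset Printing Implicit Defensive.
Import Order.TTheory GRing.Theory Num.Theory.
Local Open Scope ring_scope.

(** * Executions, costs and loops of query programs *)

Section Programs.
Variables (K : realFieldType) (T : finType) (f : {set T} -> K).

Lemma runs_bind (A B : Type) (p : prog K T A) (q : A -> prog K T B) b n :
  runs f (bind p q) b n ->
  exists a, exists m, exists k,
    [/\ runs f p a m, runs f (q a) b k & n = (m + k)%N].
Proof.
elim: p n => [a|X k IH|C k IH] n /=.
- by move=> h; exists a, 0%N, n.
- move=> [m -> /IH[a [m' [k' [h1 h2 ->]]]]].
  by exists a, m'.+1, k'; split=> //; exists m'.
- move=> [s sC /IH[a [m' [k' [h1 h2 ->]]]]].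
  by exists a, m', k'; split=> //; exists s.
Qed.

Lemma unstuck_bind (A B : Type) (p : prog K T A) (q : A -> prog K T B) :
  unstuck f p -> (forall a n, runs f p a n -> unstuck f (q a)) ->
  unstuck f (bind p q).
Proof.
elim: p => [a|X k IH|C k IH] /=.
- by move=> _ /(_ a 0%N); apply.
- by move=> h1 h2; apply: IH => // a n h; apply: (h2 a n.+1); exists n.
- move=> [C0 h1] h2; split=> // s sC; apply: IH; first exact: h1.
  by move=> a n h; apply: (h2 a n); exists s.
Qed.

Definition evaluates (p : prog K T K) (v : K) (c : nat) :=
  forall w n, runs f p w n -> w = v /\ n = c.

Lemma evaluates_value y : evaluates (value K y) (f [set y]) 1.
Proof. by move=> v n [m -> [-> ->]]. Qed.

Lemma evaluates_marginal S y : evaluates (marginal K S y) (f (y |: S) - f S) 2.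
Proof. by move=> v n [m -> [k -> [-> ->]]]. Qed.

Section Argmax.
Variables (g : T -> prog K T K) (F : T -> K) (c : nat).
Hypothesis gF : forall y, evaluates (g y) (F y) c.

Lemma runs_tabulate ys t n : runs f (tabulate g ys) t n ->
  {in ys, t =1 F} /\ n = (c * size ys)%N.
Proof.
elim: ys t n => [|y ys IH] t n /=; first by move=> [-> ->]; rewrite muln0.
move=> h; have [v [m [k [hg hk ->]]]] := runs_bind h; have [vE ->] := gF hg.
have [u [i [j [/IH[hu ->] [tE ->] ->]]]] := runs_bind hk.
rewrite addn0 mulnS; split=> // z; rewrite tE vE inE.
by case: eqP => [->//|_] /= /hu.
Qed.

Lemma runs_pick_argmax (C : {set T}) s n : runs f (pick_argmax C g) s n ->
  [/\ s \in C, forall y, y \in C -> F y <= F s & n = (c * #|C|)%N].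
Proof.
move=> h; have [t [m [k [/runs_tabulate[tF ->] [s' + [-> ->]] ->]]]] := runs_bind h.
rewrite inE addn0 -cardE => /andP[sC /forall_inP tmax]; split=> // y yC.
by rewrite -!tF ?mem_enum ?tmax.
Qed.

Lemma unstuck_pick_argmax (C : {set T}) :
  (forall y, unstuck f (g y)) -> C != set0 -> unstuck f (pick_argmax C g).
Proof.
move=> gU /set0Pn[y0 y0C]; apply: unstuck_bind.
  elim: (enum C) => //= y ys IH.
  by apply: unstuck_bind => // v _ _; apply: unstuck_bind.
move=> t n _ /=; split=> //; apply/set0Pn.
have [y yC ymax] := @arg_maxP _ _ _ y0 (mem C) t y0C.
by exists y; rewrite inE; apply/andP; split=> //; apply/forall_inP.
Qed.

End Argmax.

Lemma exec_actP (p : store T -> prog K T (store T)) s s' n :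
  exec f (Act p) s s' n -> runs f (p s) s' n.
Proof. by move=> h; inversion h; subst. Qed.

Lemma exec_seqP c1 c2 s s'' k : exec f (Seq c1 c2) s s'' k ->
  exists s', exists m, exists n,
    [/\ exec f c1 s s' m, exec f c2 s' s'' n & k = (m + n)%N].
Proof. by move=> h; inversion h; subst; exists s', m, n. Qed.

Lemma exec_whileP (b : store T -> bool) (c : cmd K T) s s'' k :
  exec f (While b c) s s'' k ->
  [/\ ~~ b s, s'' = s & k = 0%N] \/
  b s /\ exists s', exists m, exists n,
    [/\ exec f c s s' m, exec f (While b c) s' s'' n & k = (m + n)%N].
Proof.
move=> h; inversion h; subst; first by left.
by right; split=> //; exists s', m, n.
Qed.

(** A Hoare rule for total correctness and cost at once. Induction on [mu] works because every
    iteration lowers [mu], so there are at most [mu s] of them, each paying at most [k] queries. *)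
Lemma while_rule (Inv : store T -> Prop) (mu : store T -> nat) (k : nat)
    (b : store T -> bool) (p : store T -> prog K T (store T)) :
  (forall s, Inv s -> b s -> unstuck f (p s)) ->
  (forall s s' n, Inv s -> b s -> runs f (p s) s' n ->
     [/\ Inv s', (mu s' < mu s)%N & (n <= k)%N]) ->
  forall s, Inv s ->
    halts f (While b (Act p)) s /\
    forall s' n, exec f (While b (Act p)) s s' n ->
      [/\ Inv s', ~~ b s' & (n <= k * mu s)%N].
Proof.
move=> pU pI s; have [m] := ubnP (mu s); elim: m s => // m IH s lt_s Is.
have [bs|nbs] := boolP (b s); last first.
  split; first exact: halts_while_end.
  by move=> s' n /exec_whileP[[_ -> ->]|[]] //; rewrite (negbTE nbs).
have step s' n : runs f (p s) s' n -> (mu s' < m)%N.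
  by move=> /(pI _ _ _ Is bs)[_ lt _]; apply: leq_trans lt _.
split.
  apply: halts_while_step => //; first by apply: halts_act; apply: pU.
  move=> s' n /exec_actP h; have [Is' _ _] := pI _ _ _ Is bs h.
  by have [] := IH s' (step _ _ h) Is'.
move=> s'' n /exec_whileP[[]|[_ [s' [i [j [/exec_actP h1 h2 ->]]]]]].
  by rewrite bs.
have [Is' lt le_i] := pI _ _ _ Is bs h1.
have [_ /(_ _ _ h2)[Is'' nbs'' le_j]] := IH s' (step _ _ h1) Is'.
split=> //; apply: (@leq_trans (k * (mu s').+1)); last by rewrite leq_mul2l lt orbT.
by rewrite mulnS leq_add.
Qed.

End Programs.

(** * Submodularity and curvature *)

Section SetFunctionFacts.
Variables (K : realFieldType) (T : finType) (f : {set T} -> K).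
Hypotheses (f_mono : nondecreasing_setfun f) (f_sub : submodular f).
Hypothesis f0 : f set0 = 0.

Lemma setfun_ge0 X : 0 <= f X.
Proof. by rewrite -f0 f_mono ?sub0set. Qed.

(** Insert the elements of [A] one by one: by submodularity each gains at most what it gains over
    [set0], namely its singleton value. *)
Lemma setfun_subadditive (X A : {set T}) :
  f (X :|: A) <= f X + \sum_(a in A) f [set a].
Proof.
rewrite -big_enum /= -{1}(set_enum A).
elim: (enum A) => [|x s IH].
  by rewrite big_nil addr0 (_ : [set x in [::]] = set0) ?setU0.
have := f_sub x (sub0set (X :|: [set a in s])).
rewrite big_cons setU0 f0 (_ : x |: _ = X :|: [set a in x :: s]).
  by move: IH; lra.
by apply/setP=> y; rewrite !inE; do !case: (_ \in _); do ?case: (_ == _).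
Qed.

(** The largest value on [A] separates the two sums: it bounds every term over [A] from above and
    every term over [B] from below. *)
Lemma sum_le_card (F : T -> K) (A B : {set T}) : (forall x, 0 <= F x) ->
  (forall a b, a \in A -> b \in B -> F a <= F b) -> (#|A| <= #|B|)%N ->
  \sum_(a in A) F a <= \sum_(b in B) F b.
Proof.
move=> F0 le_F le_AB; have [->|[a0 a0A]] := set_0Vmem A.
  by rewrite big_set0 sumr_ge0.
have [a aA amax] := @arg_maxP _ _ _ a0 (mem A) F a0A.
apply: (@le_trans _ _ (F a *+ #|A|)).
  by rewrite -sumr_const; apply: ler_sum.
apply: (@le_trans _ _ (F a *+ #|B|)); first exact: ler_wpMn2l.
by rewrite -sumr_const; apply: ler_sum => b bB; exact: le_F.
Qed.

Hypothesis f1 : forall s, f [set s] != 0.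

Lemma setfun1_gt0 s : 0 < f [set s].
Proof. by rewrite lt_def f1 setfun_ge0. Qed.

Variable I : {set {set T}}.

Lemma curvature_marginal S s : S \in I -> s \in S ->
  (1 - constrained_curvature f I) * f [set s] <= f S - f (S :\ s).
Proof.
move=> SI sS; rewrite /constrained_curvature subKr.
rewrite -ler_pdivlMr ?setfun1_gt0 //.
have I0 : I != set0 by apply/set0Pn; exists S.
have S0 : S != set0 by apply/set0Pn; exists s.
apply: le_trans ((min_overP _ I0).2 S SI) _.
exact: (min_overP (fun s => (f S - f (S :\ s)) / f [set s]) S0).2.
Qed.

Lemma compl_curvature_ge0 : I != set0 -> set0 \notin I ->
  0 <= 1 - constrained_curvature f I.
Proof.
move=> I0 nI; rewrite /constrained_curvature subKr.
have [[S SI <-] _] := min_overP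
  (fun S => min_over S (fun s => (f S - f (S :\ s)) / f [set s])) I0.
have S0 : S != set0 by apply: contraNneq nI => <-.
have [[s sS <-] _] := min_overP (fun s => (f S - f (S :\ s)) / f [set s]) S0.
by rewrite divr_ge0 ?setfun_ge0 // subr_ge0 f_mono ?subD1set.
Qed.

(** Build [X] one element at a time. The elements already inserted lie in [S :\ x], so by
    submodularity [x] gains at least its marginal over [S :\ x], which the curvature controls. *)
Lemma curvature_sum (S X : {set T}) : S \in I -> X \subset S ->
  (1 - constrained_curvature f I) * \sum_(x in X) f [set x] <= f X.
Proof.
move=> SI XS; rewrite -big_enum /= -{2}(set_enum X).
have : {subset enum X <= S} by move=> x; rewrite mem_enum; apply: (subsetP XS).
elim: (enum X) (enum_uniq X) => [|x s IH] /=.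
  by rewrite big_nil mulr0 setfun_ge0.
move=> /andP[xs us] sS; rewrite big_cons mulrDr.
have xS : x \in S by apply: sS; rewrite mem_head.
have {}IH := IH us (fun y ys => sS y (mem_behead (s := x :: s) ys)).
have sub : [set y in s] \subset S :\ x.
  apply/subsetP=> y; rewrite !inE => ys; rewrite sS ?inE ?ys ?orbT // andbT.
  by apply: contraNneq xs => <-.
have := f_sub x sub; have := curvature_marginal SI xS.
rewrite setD1K // (_ : x |: _ = [set y in x :: s]).
  by move: IH; lra.
by apply/setP=> y; rewrite !inE.
Qed.

End SetFunctionFacts.

(** * Invariants and correctness of the two greedy loops *)

Section Algorithm.
Variables (K : realFieldType) (Rb T : finType) (Tr : Rb -> {set T}).
Variables (f : {set T} -> K) (alpha : nat) (rob : T -> Rb).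
Hypothesis TrE : forall x r, (x \in Tr r) = (rob x == r).
Hypothesis Tr0 : forall r, Tr r != set0.
Hypotheses (f_mono : nondecreasing_setfun f) (f_sub : submodular f).
Hypothesis f0 : f set0 = 0.
Hypothesis alphaR : (alpha < #|Rb|)%N.

Lemma all_trajectoriesE : all_trajectories Tr = setT.
Proof.
by apply/setP=> x; rewrite in_setT; apply/bigcupP; exists (rob x); rewrite // TrE.
Qed.

Lemma robot_onto : rob @: setT = setT.
Proof.
apply/setP=> r; rewrite in_setT; have /set0Pn[x xr] := Tr0 r.
by apply/imsetP; exists x; rewrite // (eqP (etrans (esym (TrE x r)) xr)).
Qed.

Lemma at_most_one_eachP (S : {set T}) :
  reflect {in S &, injective rob} (at_most_one_each Tr S).
Proof.
apply: (iffP forallP) => [le1 x y xS yS xy|inj r].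
  by apply: (card_le1_eqP (le1 (rob x))); rewrite !inE ?xS ?yS TrE ?xy eqxx.
apply/card_le1_eqP=> x y; rewrite !inE !TrE.
by move=> /andP[xS /eqP <-] /andP[yS /eqP]; move/inj=> ->.
Qed.

Lemma assignmentsE (S : {set T}) :
  (S \in assignments Tr) = at_most_one_each Tr S && (rob @: S == setT).
Proof.
rewrite inE all_trajectoriesE subsetT /=; apply/idP/idP.
  move=> /forallP S1; apply/andP; split.
    by apply/forallP=> r; rewrite (eqP (S1 r)).
  apply/eqP/setP=> r; rewrite in_setT; apply/imsetP.
  have /cards1P[x /setP/(_ x)] := S1 r.
  by rewrite !inE eqxx TrE => /andP[xS /eqP <-]; exists x.
move=> /andP[/forallP S1 /eqP onto]; apply/forallP=> r.
rewrite eqn_leq S1 card_gt0; apply/set0Pn.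
have /imsetP[x xS ->] : r \in rob @: S by rewrite onto in_setT.
by exists x; rewrite inE xS TrE eqxx.
Qed.

Lemma at_most_one_setU1 (S : {set T}) s : at_most_one_each Tr S -> s \notin S ->
  at_most_one_each Tr (s |: S) = (rob s \notin rob @: S).
Proof.
move=> /at_most_one_eachP injS sS; apply/at_most_one_eachP/idP => [inj|nS].
  apply: contra sS => /imsetP[x xS sx].
  by rewrite (inj s x) ?setU11 // setU1r.
move=> x y /setU1P[->|xS] /setU1P[->|yS] xy //; last exact: injS.
- by case/negP: nS; rewrite xy imset_f.
- by case/negP: nS; rewrite -xy imset_f.
Qed.

(** [p1_seen] keeps the two possible reasons for a rejection. [p1_top] ranges over all trajectories
    of unserved robots, seen or not, because the second loop selects among these. *)
Record phase1_inv (st : store T) : Prop := Phase1Inv {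
  p1_one : at_most_one_each Tr (sol1 st);
  p1_card : (#|sol1 st| <= alpha)%N;
  p1_sub : sol1 st \subset seen1 st;
  p1_seen x : x \in seen1 st ->
    rob x \in rob @: sol1 st \/ (alpha <= #|sol1 st|)%N;
  p1_top s x : s \in sol1 st -> rob x \notin rob @: sol1 st ->
    f [set x] <= f [set s];
  p1_sol2 : sol2 st = set0;
  p1_seen2 : seen2 st = set0 }.

(* [greedy] compares [S2] with a competing choice [O] for the robots not served
   by [S1]: only the part of [O] whose robots are already served by [S2] enters,
   which makes the statement inductive. *)
Record phase2_inv (S1 : {set T}) (st : store T) : Prop := Phase2Inv {
  p2_sol1 : sol1 st = S1;
  p2_one : at_most_one_each Tr (S1 :|: sol2 st);
  p2_sub : sol2 st \subset seen2 st;
  p2_seen_sub : seen2 st \subset ~: S1;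
  p2_seen x : x \in seen2 st -> rob x \in rob @: (S1 :|: sol2 st);
  p2_greedy (O : {set T}) : at_most_one_each Tr O ->
    [disjoint rob @: O & rob @: S1] ->
    f (sol2 st :|: [set o in O | rob o \in rob @: sol2 st]) <= f (sol2 st) *+ 2 }.

Lemma card_setC_setU1 (M : {set T}) s : s \notin M -> (#|~: (s |: M)| < #|~: M|)%N.
Proof.
move=> sM; apply: proper_card; apply/properP; split.
  by rewrite setCS subsetU1.
by exists s; rewrite !inE ?eqxx.
Qed.

Lemma body1_runs st st' n : phase1_inv st -> runs f (body1 K Tr alpha st) st' n ->
  [/\ phase1_inv st', (#|~: seen1 st'| < #|~: seen1 st|)%N & (n <= #|T|)%N].
Proof.
case: st => S1 M1 S2 M2 [/= one card sub seen top -> ->] h.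
have [s [m [k [hs [-> ->] ->]]]] := runs_bind h.
have [+ smax ->] := runs_pick_argmax (@evaluates_value K T f) hs.
rewrite all_trajectoriesE in smax *; rewrite !inE andbT => sM.
have sS : s \notin S1 by apply: contra sM; apply: (subsetP sub).
split; [|exact: card_setC_setU1|by rewrite addn0 mul1n max_card].
have sub' : S1 \subset s |: M1 by apply: subset_trans sub (subsetU1 _ _).
rewrite at_most_one_setU1 // cardsU1 sS add1n.
case: ifPn => [/andP[nS lt_a]|rej]; split=> //=.
- by rewrite at_most_one_setU1.
- by rewrite cardsU1 sS.
- exact: setUS.
- move=> x /setU1P[->|/seen[xS|le]]; first by left; rewrite imset_f ?setU11.
    by left; apply: (subsetP (imsetS _ (subsetU1 _ _))) xS.
  by have := leq_trans lt_a le; rewrite ltnn.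
- move=> t x /setU1P[->|tS] xS.
    (* Had [x] been seen already, its robot would be served or the bait set full; both are excluded,
       so [x] competed with the chosen [s]. *)
    apply: smax; rewrite !inE andbT; apply: contra xS => /seen[xS|le].
      exact: (subsetP (imsetS _ (subsetU1 _ _))) xS.
    by have := leq_trans lt_a le; rewrite ltnn.
  apply: top => //; apply: contra xS.
  exact: (subsetP (imsetS _ (subsetU1 _ _))).
- move=> x /setU1P[->|/seen //]; move: rej.
  by rewrite negb_and negbK -leqNgt => /orP[]; [left|right].
Qed.

(** With fewer than [alpha] baits, rejections come only from served robots, so all robots would be
    served by at most [alpha] trajectories, against [alphaR]. *)
Lemma phase1_end st : phase1_inv st -> seen1 st = setT -> #|sol1 st| = alpha.
Proof.
case=> _ card _ seen _ _ _ all; apply/eqP; rewrite eqn_leq card.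
rewrite leqNgt; apply: contraL alphaR => lt.
rewrite -leqNgt -cardsT -robot_onto; apply: leq_trans card.
apply: leq_trans (leq_imset_card rob _); apply: subset_leq_card.
apply/subsetP=> _ /imsetP[x _ ->].
have [|//|] := seen x; first by rewrite all in_setT.
by rewrite leqNgt lt.
Qed.

Lemma body2_runs S1 st st' n : phase2_inv S1 st -> runs f (body2 K Tr st) st' n ->
  [/\ phase2_inv S1 st', (#|~: seen2 st'| < #|~: seen2 st|)%N
    & (n <= 2 * #|T|)%N].
Proof.
case: st => S1' M1 S2 M2 [/= -> one sub seenS1 seen greedy] h.
have [s [m [k [hs [-> ->] ->]]]] := runs_bind h.
have [+ smax ->] := runs_pick_argmax (@evaluates_marginal K T f S2) hs.
rewrite all_trajectoriesE in smax *; rewrite !inE andbT negb_or => /andP[sS1 sM].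
have sS2 : s \notin S2 by apply: contra sM; apply: (subsetP sub).
split; [|exact: card_setC_setU1|by rewrite addn0 leq_mul2l max_card].
have sS : s \notin S1 :|: S2 by rewrite inE negb_or sS1.
have seenS1' : s |: M2 \subset ~: S1 by rewrite subUset sub1set inE sS1.
rewrite setUCA at_most_one_setU1 //.
case: ifPn => [nS|/negPn sR]; split=> //=.
- by rewrite setUCA at_most_one_setU1.
- exact: setUS.
- rewrite setUCA => x /setU1P[->|/seen]; first by rewrite imset_f ?setU11.
  exact: (subsetP (imsetS _ (subsetU1 _ _))).
- move=> O oneO disj; have := greedy O oneO disj.
  set U := [set o in O | _] => IH.
  have step_s := f_sub s (subsetUl S2 U).
  (* Serving [rob s] brings into the left side [s] and the at most one [o] of [O] with that robot.
     Each gains at most the marginal of [s] over [S2], the first by submodularity, the second also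
     by the greedy choice; the right side grows by twice that marginal. *)
  have [/exists_inP[o oO /eqP os]|no] := boolP [exists o in O, rob o == rob s].
    have -> : s |: S2 :|: [set o in O | rob o \in rob @: (s |: S2)]
        = o |: (s |: (S2 :|: U)).
      apply/setP=> x; rewrite imsetU1 !inE.
      have -> : (x \in O) && ((rob x == rob s) || (rob x \in rob @: S2)) =
          (x == o) || (x \in O) && (rob x \in rob @: S2).
        have [->|xo] := eqVneq x o; first by rewrite oO os eqxx.
        have [xO|//] := boolP (x \in O); rewrite /= -os.
        case: eqP => // /(at_most_one_eachP _ oneO x o xO oO) xo'.
        by rewrite xo' eqxx in xo.
      by case: (x == s); case: (x == o); case: (x \in S2).
    have sub_o : S2 \subset s |: (S2 :|: U).
      by rewrite subsetU // subsetUl orbT.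
    (* [o] was still a candidate: [O] avoids the robots of [S1], and had [o] been seen, its robot
       [rob s] would be served and [s] rejected. *)
    have oC : o \in [set: T] :\: (S1 :|: M2).
      rewrite !inE andbT negb_or; apply/andP; split.
        apply: contraL disj => oS1; apply/pred0Pn; exists (rob o).
        by rewrite /= !imset_f.
      by apply: contra nS => /seen; rewrite os.
    have := smax o oC; have := f_sub o sub_o; move: step_s IH.
    by rewrite !mulr2n; lra.
  have -> : s |: S2 :|: [set o in O | rob o \in rob @: (s |: S2)]
      = s |: (S2 :|: U).
    apply/setP=> x; rewrite imsetU1 !inE -!orbA; do 2!congr (_ || _).
    have [xO|//] := boolP (x \in O); rewrite /=.
    by case: eqP => // xs; case/negP: no; apply/exists_inP; exists x; rewrite ?xs.
  (* Only [s] enters the left side here, so one marginal is spent; monotonicity makes the other one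
     nonnegative. *)
  have := f_mono (subsetU1 s S2); move: step_s IH.
  by rewrite !mulr2n; lra.
- exact: subset_trans sub (subsetU1 _ _).
- by move=> x /setU1P[->|/seen].
Qed.

Lemma body1_unstuck st : phase1_inv st -> seen1 st != all_trajectories Tr ->
  unstuck f (body1 K Tr alpha st).
Proof.
case: st => S1 M1 S2 M2 _ /=; rewrite all_trajectoriesE => nT.
apply: unstuck_bind => //; apply: unstuck_pick_argmax => //.
by rewrite setD_eq0 subTset.
Qed.

Lemma body2_unstuck S1 st : phase2_inv S1 st ->
  seen2 st != all_trajectories Tr :\: sol1 st -> unstuck f (body2 K Tr st).
Proof.
case: st => S1' M1 S2 M2 [/= -> _ _ sub _ _]; rewrite all_trajectoriesE setTD => nT.
apply: unstuck_bind => //; apply: unstuck_pick_argmax => //.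
apply: contra nT; rewrite setD_eq0 subTset => /eqP all.
rewrite eqEsubset sub; apply/subsetP=> x; have : x \in S1 :|: M2 by rewrite all.
by rewrite !inE => /orP[->|->].
Qed.

Lemma phase2_init st : phase1_inv st -> phase2_inv (sol1 st) st.
Proof.
case=> one _ _ _ _ S20 M20; split=> //; rewrite ?S20 ?M20 ?setU0 ?sub0set //.
  by move=> x; rewrite inE.
move=> O _ _; rewrite imset0 set0U (_ : [set o in O | _] = set0) ?f0 ?mul0rn //.
by apply/setP=> x; rewrite !inE andbF.
Qed.

Lemma alg1_correct :
  alg1_terminates Tr alpha f /\
  forall S n, alg1_returns Tr alpha f S n -> exists S1 S2 : {set T},
    [/\ S = S1 :|: S2, [disjoint S1 & S2], S \in assignments Tr & #|S1| = alpha]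
    /\ [/\ forall s t, s \in S1 -> t \in S2 -> f [set t] <= f [set s],
           forall O : {set T}, at_most_one_each Tr O ->
             [disjoint rob @: O & rob @: S1] -> f O <= f S2 *+ 2
         & (n <= 3 * #|T| ^ 2)%N].
Proof.
have inv0 : phase1_inv (alg1_init T).
  split=> //=; rewrite ?cards0 //; try by move=> ?; rewrite inE.
  by apply/at_most_one_eachP=> x; rewrite inE.
have [halt1 loop1] := while_rule body1_unstuck
  (fun s s' n inv _ h => @body1_runs s s' n inv h) inv0.
have loop2 st (inv : phase1_inv st) := while_rule (@body2_unstuck (sol1 st))
  (fun s s' n inv _ h => @body2_runs (sol1 st) s s' n inv h) (phase2_init inv).
split.
  by apply: halts_seq => // st n /loop1[/loop2[]].
move=> S n [st /exec_seqP[st1 [n1 [n2 [/loop1[inv1 /negPn end1 le1]]]]]].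
have [_ h2] := loop2 _ inv1; move=> /h2[inv2 /negPn end2 le2] -> ->.
have card1 : #|sol1 st1| = alpha.
  by apply: phase1_end => //; rewrite (eqP end1) all_trajectoriesE.
move: inv2 end2; case: st {h2 le2} (le2) => S1 M1 S2 M2 le2.
case=> /= -> one sub _ seen greedy; rewrite all_trajectoriesE setTD => /eqP end2.
have dis : [disjoint sol1 st1 & S2].
  by rewrite disjoint_sym disjoints_subset -end2.
have onto x : rob x \in rob @: (sol1 st1 :|: S2).
  have [xM|] := boolP (x \in M2); first exact: seen.
  by rewrite end2 inE negbK => xS; rewrite imset_f // inE xS.
have in2 x : rob x \notin rob @: sol1 st1 -> rob x \in rob @: S2.
  by have := onto x; rewrite imsetU inE => /orP[->|].
exists (sol1 st1), S2; split; split=> //.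
- rewrite assignmentsE one; apply/eqP/setP=> r; rewrite in_setT.
  by move: (in_setT r); rewrite -robot_onto => /imsetP[x _ ->]; exact: onto.
- move=> s t sS tS; apply: (p1_top inv1) => //.
  (* A robot shared by [t] and a bait [x] would force [t = x], as the output has one trajectory per
     robot. *)
  apply: contraL dis => /imsetP[x xS tx]; apply/pred0Pn; exists t => /=.
  by rewrite tS (at_most_one_eachP _ one t x) ?xS // inE ?tS ?xS ?orbT.
(* At the end every robot outside those of [S1] is served by [S2], so the restriction in [p2_greedy]
   keeps all of [O]. *)
- move=> O oneO disO; apply: le_trans (greedy O oneO disO); apply: f_mono.
  apply/subsetP=> x xO; rewrite !inE xO in2 ?orbT //.
  apply: contraL disO => xS; apply/pred0Pn; exists (rob x).
  by rewrite /= xS imset_f.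
(* A candidate costs one query in the first loop and two in the second, whence [3 = 1 + 2]. *)
- apply: leq_trans (leq_add le1 le2) _; rewrite -[3%N]/(1 + 2)%N mulnDl mul1n.
  rewrite -mulnn mulnA; apply: leq_add; rewrite leq_mul2l max_card ?orbT //.
Qed.

End Algorithm.

(** * What survives a removal, compared with [f S2] *)

Section Approximation.
Variables (K : realFieldType) (T : finType) (f : {set T} -> K) (alpha : nat).
Hypotheses (f_mono : nondecreasing_setfun f) (f_sub : submodular f).
Hypothesis f0 : f set0 = 0.
Variables S1 S2 A : {set T}.
Hypotheses (dis : [disjoint S1 & S2]) (card1 : #|S1| = alpha).
Hypothesis top : forall s t, s \in S1 -> t \in S2 -> f [set t] <= f [set s].
Hypothesis remA : A \in removals alpha (S1 :|: S2).

(** The attack has at most [alpha = #|S1|] removals, so each one spent on [S2] spares an element of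
    [S1]. *)
Lemma card_removed : (#|S2 :&: A| <= #|S1 :\: A|)%N.
Proof.
move: remA; rewrite inE => /andP[/setIidPr AS leA].
rewrite -(leq_add2l #|S1 :&: A|) cardsID card1; apply: leq_trans leA.
rewrite -cardsUI -setIUl AS (_ : _ :&: _ = set0) ?cards0 ?addn0 //.
by rewrite setIACA (disjoint_setI0 dis) set0I.
Qed.

(** Bound [f S2] by its singleton sum; the part over [S2 :\: A] survives, and the part over
    [S2 :&: A] is exchanged for the surviving baits by [sum_le_card]. *)
Lemma survivors_ge_curvature (I : {set {set T}}) : (forall s, f [set s] != 0) ->
  S1 :|: S2 \in I -> 0 <= 1 - constrained_curvature f I ->
  (1 - constrained_curvature f I) * f S2 <= f ((S1 :|: S2) :\: A).
Proof.
move=> f1 SI c0; apply: le_trans (curvature_sum f_mono f_sub f0 f1 SI (subsetDl _ A)).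
apply: ler_wpM2l => //; have := setfun_subadditive f_sub f0 set0 S2.
rewrite set0U f0 add0r => /le_trans; apply.
rewrite setDUl (big_setID A) /=.
have -> : \sum_(x in S1 :\: A :|: S2 :\: A) f [set x] =
    \sum_(x in S1 :\: A) f [set x] + \sum_(x in S2 :\: A) f [set x].
  rewrite -bigU /=; last exact: disjointW (subsetDl _ _) (subsetDl _ _) dis.
  by apply: eq_bigl => x; rewrite !inE.
rewrite lerD2r; apply: sum_le_card => [x|t s|]; last exact: card_removed.
  exact: setfun_ge0.
by rewrite !inE => /andP[tS2 _] /andP[_ sS1]; apply: top.
Qed.

Lemma survivors_ge_removed : S2 :&: A != set0 ->
  forall t, t \in S2 -> f [set t] <= f ((S1 :|: S2) :\: A).
Proof.
rewrite -card_gt0 => /leq_trans/(_ card_removed); rewrite card_gt0.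
case/set0Pn=> s; rewrite !inE => /andP[sA sS1] t tS2.
apply: le_trans (top sS1 tS2) _; apply: f_mono.
by rewrite sub1set !inE sA sS1.
Qed.

(** The surviving part of [S2] costs one copy of the remaining value, and each of the at most
    [alpha] removed elements costs one more. *)
Lemma survivors_ge_alpha : f S2 <= (1 + alpha%:R) * f ((S1 :|: S2) :\: A).
Proof.
set g := f (_ :\: _); have g0 : 0 <= g by apply: setfun_ge0.
have le_g : f (S2 :\: A) <= g by apply: f_mono; rewrite setSD ?subsetUr.
have := setfun_subadditive f_sub f0 (S2 :\: A) (S2 :&: A).
rewrite setUC setID => /le_trans; apply; rewrite mulrDl mul1r lerD //.
have [->|ne] := eqVneq (S2 :&: A) set0.
  by rewrite big_set0 mulr_ge0.
apply: (@le_trans _ _ (\sum_(t in S2 :&: A) g)).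
  apply: ler_sum => t; rewrite inE => /andP[tS2 _].
  exact: survivors_ge_removed.
rewrite sumr_const -(mulr_natl g); apply: ler_wpM2r => //; rewrite ler_nat.
move: remA; rewrite inE => /andP[_]; apply: leq_trans.
by rewrite subset_leq_card ?subsetIr.
Qed.

Lemma survivors_ge_card : (0 < #|S2|)%N ->
  f S2 <= #|S2|%:R * f ((S1 :|: S2) :\: A).
Proof.
move=> S20; set g := f (_ :\: _); have g0 : 0 <= g by apply: setfun_ge0.
have [e|ne] := eqVneq (S2 :&: A) set0.
  apply: (@le_trans _ _ g); last by rewrite ler_peMl // ler1n.
  apply: f_mono; rewrite -[S2 in X in X \subset _](setID S2 A) e set0U.
  by rewrite setSD ?subsetUr.
have := setfun_subadditive f_sub f0 set0 S2.
rewrite set0U f0 add0r => /le_trans; apply.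
rewrite mulr_natl -sumr_const; apply: ler_sum => t tS2.
exact: survivors_ge_removed.
Qed.

End Approximation.

(** * Bounds on the resilient optimum *)

Section Optimum.
Variables (K : realFieldType) (Rb T : finType) (Tr : Rb -> {set T}).
Variables (f : {set T} -> K) (alpha : nat) (rob : T -> Rb).
Hypothesis TrE : forall x r, (x \in Tr r) = (rob x == r).

Lemma removals_neq0 (S : {set T}) : removals alpha S != set0.
Proof. by apply/set0Pn; exists set0; rewrite inE sub0set cards0. Qed.

(** Against an optimal [O] the adversary may delete the trajectories of the robots of [S1]: there
    are at most [#|S1|] of them, and what is left is a competitor bounded by [b]. *)
Lemma resilient_opt_le (S1 : {set T}) (b : K) : (#|S1| <= alpha)%N ->
  assignments Tr != set0 ->
  (forall O : {set T}, at_most_one_each Tr O ->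
     [disjoint rob @: O & rob @: S1] -> f O <= b) ->
  resilient_opt f alpha (assignments Tr) <= b.
Proof.
move=> card1 I0 le_b; rewrite /resilient_opt.
have [[O OI <-] _] := max_overP
  (fun S => min_over (removals alpha S) (fun A => f (S :\: A))) I0.
pose A := [set o in O | rob o \in rob @: S1].
have /andP[/(at_most_one_eachP TrE) injO _] := etrans (esym (assignmentsE TrE O)) OI.
have AO : A \subset O by apply/subsetP=> x; rewrite inE => /andP[].
have remA : A \in removals alpha O.
  rewrite inE AO; apply: leq_trans card1.
  rewrite -(card_in_imset (f := rob) (D := mem A)); last first.
    by move=> x y xA yA; apply: injO; apply: (subsetP AO).
  apply: leq_trans (leq_imset_card rob S1); apply: subset_leq_card.
  by apply/subsetP=> _ /imsetP[x + ->]; rewrite inE => /andP[].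
have [_ leO] := min_overP (fun A => f (O :\: A)) (removals_neq0 O).
apply: le_trans (leO A remA) _; apply: le_b.
  apply/(at_most_one_eachP TrE) => x y; rewrite !inE => /andP[_ xO] /andP[_ yO].
  exact: injO.
apply/pred0Pn=> -[_ /andP[/= /imsetP[x + ->]]].
by rewrite !inE => /andP[/nandP[/negP|/negP] //].
Qed.

(** Makes the approximation ratio a genuine quotient: [alpha] removals cannot empty an assignment,
    which has at least [#|Rb|] elements. *)
Lemma resilient_opt_gt0 (S : {set T}) : nondecreasing_setfun f ->
  (forall s, 0 < f [set s]) -> (alpha < #|Rb|)%N -> S \in assignments Tr ->
  0 < resilient_opt f alpha (assignments Tr).
Proof.
move=> f_mono f1 alphaR SI; rewrite /resilient_opt.
have I0 : assignments Tr != set0 by apply/set0Pn; exists S.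
have [_ /(_ S SI)] := max_overP
  (fun S => min_over (removals alpha S) (fun A => f (S :\: A))) I0.
apply: lt_le_trans.
have [[A + <-] _] := min_overP (fun A => f (S :\: A)) (removals_neq0 S).
rewrite inE => /andP[_ leA].
have /set0Pn[s sSA] : S :\: A != set0.
  rewrite setD_eq0; apply: contraL alphaR => /subset_leq_card leS.
  rewrite -leqNgt; apply: leq_trans (leq_trans leS leA).
  move: SI; rewrite (assignmentsE TrE) => /andP[_ /eqP onto].
  by rewrite -cardsT -onto leq_imset_card.
by apply: lt_le_trans (f1 s) _; apply: f_mono; rewrite sub1set.
Qed.

End Optimum.

(** * Assembling the guarantees *)

Theorem theorem1 :
  exists C : nat,
  forall (K : realFieldType) (Rb T : finType) (Tr : Rb -> {set T})
         (f : {set T} -> K) (alpha : nat),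
    (0 < #|Rb|)%N ->
    (forall r, Tr r != set0) ->
    (forall r r', r != r' -> [disjoint Tr r & Tr r']) ->
    all_trajectories Tr = [set: T] ->
    nondecreasing_setfun f ->
    submodular f ->
    f set0 = 0 ->
    (forall s, f [set s] != 0) ->
    (alpha < #|Rb|)%N ->
    alg1_terminates Tr alpha f /\
    forall (S : {set T}) (n : nat), alg1_returns Tr alpha f S n ->
      (S \in assignments Tr /\
       forall A : {set T}, worst_removal f alpha S A ->
         Num.max (1 - constrained_curvature f (assignments Tr))
                 (h_bound K #|Rb| alpha) / 2
         <= f (S :\: A) / resilient_opt f alpha (assignments Tr))
      /\ (n <= C * #|all_trajectories Tr| ^ 2)%N.
Proof.
exists 3%N => K Rb T Tr f alpha R0 Tr0 disTr TrT f_mono f_sub f0 f1 alphaR.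
(* Covering and disjointness turn the family [Tr] into an owner map [rob]. *)
have /fin_all_exists[rob robP] : forall x, exists r, x \in Tr r.
  by move=> x; have := in_setT x; rewrite -TrT => /bigcupP[r _ xr]; exists r.
have TrE x r : (x \in Tr r) = (rob x == r).
  apply/idP/eqP=> [xr|<-//]; apply/eqP/negPn/negP => /disTr.
  by move=> /disjointFr/(_ (robP x)); rewrite xr.
have [halt ret] := alg1_correct TrE Tr0 f_mono f_sub f0 alphaR.
split=> // _ n /ret[S1 [S2 [[-> dis SI card1] [top greedy le_n]]]].
rewrite TrT cardsT; split=> //; split=> // A [remA _].
have I0 : assignments Tr != set0 by apply/set0Pn; exists (S1 :|: S2).
have fgt0 := setfun1_gt0 f_mono f0 f1.
have opt0 := resilient_opt_gt0 TrE f_mono fgt0 alphaR SI.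
have opt_le := resilient_opt_le TrE (eq_leq card1) I0 greedy.
have := SI; rewrite (assignmentsE TrE).
move=> /andP[/(at_most_one_eachP TrE) injS /eqP onto].
have cardS : (#|S2| + alpha = #|Rb|)%N.
  rewrite -card1 addnC -cardsUI (disjoint_setI0 dis) cards0 addn0.
  by rewrite -(card_in_imset injS) onto cardsT.
have S20 : (0 < #|S2|)%N by rewrite -(ltn_add2r alpha) add0n cardS.
have c0 : 0 <= 1 - constrained_curvature f (assignments Tr).
  apply: compl_curvature_ge0 => //; apply/negP.
  rewrite (assignmentsE TrE) imset0 => /andP[_ /eqP/setP e].
  by have [r _] := card_gt0P R0; have := e r; rewrite !inE.
rewrite ler_pdivlMr //.
(* The final factor 1/2 comes from [opt_le], the greedy bound by [f S2 *+ 2]. *)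
have bound m : 0 <= m -> m * f S2 <= f ((S1 :|: S2) :\: A) ->
    m / 2 * resilient_opt f alpha (assignments Tr) <= f ((S1 :|: S2) :\: A).
  move=> m0; apply: le_trans; have := ler_wpM2l m0 opt_le.
  by rewrite mulr2n; lra.
have inv_bound k : 0 < k -> f S2 <= k * f ((S1 :|: S2) :\: A) ->
    1 / k / 2 * resilient_opt f alpha (assignments Tr) <= f ((S1 :|: S2) :\: A).
  move=> k0 le_k; apply: bound; first by rewrite divr_ge0 ?ltW.
  by rewrite mul1r mulrC ler_pdivrMr // mulrC.
rewrite /h_bound maxEle; case: ifP => _; last first.
  by apply: bound => //; apply: survivors_ge_curvature card1 top remA _ _ _ _.
rewrite maxEle; case: ifP => _; apply: inv_bound.
- by rewrite subr_gt0 ltr_nat.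
(* By [cardS], the denominator [#|Rb| - alpha] is the size of [S2]. *)
- rewrite -cardS natrD addrK.
  exact: (survivors_ge_card f_mono f_sub f0 dis card1 top remA).
- by rewrite ltr_pwDl.
- exact: (survivors_ge_alpha f_mono f_sub f0 dis card1 top remA).
Qed.
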